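(* Let $n\ge 1$ and let $I\subset[n-1]$ be a subset. Define \[\mathrm{ASM}^I(n):=\{A\in\mathrm{ASM}(n)\mid r_A(i,j)\in\{r_A(i-1,j)+1,\ r_A(i+1,j)\}\text{ for all }i\in I,\ j\in[n]\},\] with the partial order induced from that of $\mathrm{ASM}(n)$. Then $\mathrm{ASM}^I(n)$ is (a realization of) the Dedekind–MacNeille completion of the parabolic Bruhat order $S_n^I$, where $S_n^I$ is embedded by sending each permutation to its permutation matrix.
   Context: $[m]=\{1,\dots,m\}$. An alternating sign matrix (ASM) is a square matrix with entries in $\{0,1,-1\}$ such that the nonzero entries in each row and each column alternate in sign and each row and each column sums to $1$; $\mathrm{ASM}(n)$ is the set of $n\times n$ ASMs. The rank matrix of $A\in\mathrm{ASM}(n)$ is $r_A(i,j)=\sum_{p=1}^i\sum_{q=1}^jA_{p,q}$, with $r_A(0,j)=r_A(i,0)=0$. The (Bruhat) order on $\mathrm{ASM}(n)$ is: $A\le B$ iff $r_A(i,j)\ge r_B(i,j)$ for all $i,j\in[n]$. A permutation $w\in S_n$ is identified with its permutation matrix, with $1$'s in positions $(i,w(i))$, so $r_w(i,j)=|\{k\le i: w(k)\le j\}|$; on $S_n$ the order above is the Bruhat order. $S_n^I=\{w\in S_n\mid w(i)<w(i+1)\text{ for all }i\in I\}$ (minimal coset representatives of $S_n/S_n(I)$, where $S_n(I)$ is generated by the simple transpositions $s_i=(i\ i{+}1)$, $i\in I$), with the order induced from the Bruhat order on $S_n$. In the definition of $\mathrm{ASM}^I(n)$ the two values $r_A(i-1,j)+1$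 and $r_A(i+1,j)$ may coincide. The Dedekind–MacNeille completion of a poset $P$ is the smallest complete lattice containing $P$ as an order embedding; equivalently, a complete lattice $L$ with an order embedding of $P$ such that every $x\in L$ satisfies $x=\bigvee_{y\in P,\,y\le x}y$ and $x=\bigwedge_{y\in P,\,y\ge x}y$ in $L$. *)

(* Defs.v *)
From HB Require Import structures.
From mathcomp Require Import all_boot all_order all_fingroup all_algebra.
From mathcomp Require Import boolp classical_sets.

Set Implicit Arguments.
Unset Strict Implicit.
Unset Printing Implicit Defensive.

Import Order.TTheory GRing.Theory Num.Theory.
Local Open Scope ring_scope.

(* Rows, columns and permuted points are numbered from 0 ('I_n), whereas the
   arguments of [rank_mx] and [rank_perm] count rows and columns, so that
   [rank_mx A i j] is r_A(i, j) with 0 <= i, j <= n as on paper.  For i : 'I_n,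
   the 1-based index i + 1 in [n] is written i.+1. *)

Definition rank_mx n (A : 'M[int]_n) (i j : nat) : int :=
  \sum_(p < n | (p < i)%N) \sum_(q < n | (q < j)%N) A p q.

(* Two numbers x, y have opposite signs iff x * y < 0. *)
Definition alternating n (f : 'I_n -> int) : bool :=
  sorted (fun x y => x * y < 0) [seq x <- [seq f k | k <- enum 'I_n] | x != 0].

Definition is_asm n (A : 'M[int]_n) : bool :=
  [&& [forall i, forall j, A i j \in [:: 0; 1; -1]],
      [forall i, alternating (fun j => A i j)],
      [forall j, alternating (fun i => A i j)],
      [forall i, \sum_j A i j == 1]
    & [forall j, \sum_i A i j == 1]].

Record asm n := Asm { asm_mx :> 'M[int]_n; _ : is_asm asm_mx }.
HB.instance Definition _ n := [isSub for @asm_mx n].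
HB.instance Definition _ n := [Choice of asm n by <:].

Definition asm_le n (A B : asm n) : bool :=
  [forall i : 'I_n, forall j : 'I_n,
     rank_mx B i.+1 j.+1 <= rank_mx A i.+1 j.+1].

Lemma rank_mx0l n (A : 'M[int]_n) j : rank_mx A 0 j = 0.
Proof. by rewrite /rank_mx big_pred0. Qed.

Lemma rank_mx0r n (A : 'M[int]_n) i : rank_mx A i 0 = 0.
Proof. by rewrite /rank_mx big1 // => p _; rewrite big_pred0. Qed.

Lemma rank_mxS n (A : 'M[int]_n) (i : 'I_n) j :
  rank_mx A i.+1 j = rank_mx A i j + \sum_(q < n | (q < j)%N) A i q.
Proof.
rewrite /rank_mx (bigD1 i) //= addrC; congr (_ + _); apply: eq_bigl => p.
by rewrite ltnS andbC -val_eqE /= ltn_neqAle.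
Qed.

Lemma rank_mx_entry n (A : 'M[int]_n) (i j : 'I_n) :
  A i j = rank_mx A i.+1 j.+1 - rank_mx A i j.+1
          - (rank_mx A i.+1 j - rank_mx A i j).
Proof.
have rowE k : \sum_(q < n | (q < k)%N) A i q = rank_mx A i.+1 k - rank_mx A i k.
  by rewrite rank_mxS addrC addKr.
rewrite -!rowE [in RHS](bigD1 j) //= -[LHS]addr0 -addrA; congr (_ + _).
apply/esym/eqP; rewrite subr_eq0; apply/eqP/eq_bigl => q.
by rewrite ltnS andbC -val_eqE /= ltn_neqAle.
Qed.

Lemma rank_mx_inj n (A B : 'M[int]_n) :
  (forall i j : 'I_n, rank_mx A i.+1 j.+1 = rank_mx B i.+1 j.+1) -> A = B.
Proof.
move=> eqAB; have eqr i j : (i <= n)%N -> (j <= n)%N -> rank_mx A i j = rank_mx B i j.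
  case: i j => [|i] [|j]; rewrite ?rank_mx0l ?rank_mx0r // => lti ltj.
  exact: (eqAB (Ordinal lti) (Ordinal ltj)).
apply/matrixP => i j; rewrite !rank_mx_entry !eqr //; exact: ltnW.
Qed.

Lemma asm_le_refl n : reflexive (@asm_le n).
Proof. by move=> A; apply/'forall_forallP => i j. Qed.

Lemma asm_le_anti n : antisymmetric (@asm_le n).
Proof.
move=> A B /andP[/'forall_forallP leAB /'forall_forallP leBA].
by apply/val_inj/rank_mx_inj => i j; apply/le_anti; rewrite leBA leAB.
Qed.

Lemma asm_le_trans n : transitive (@asm_le n).
Proof.
move=> B A C /'forall_forallP leAB /'forall_forallP leBC.
by apply/'forall_forallP => i j; apply: le_trans (leBC i j) (leAB i j).
Qed.

Fact asm_display : Order.disp_t. Proof. exact: Order.Disp tt tt. Qed.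
HB.instance Definition _ n := Order.Le_isPOrder.Build asm_display (asm n)
  (@asm_le_refl n) (@asm_le_anti n) (@asm_le_trans n).

(* An element i : 'I_n.-1 of I stands for i + 1 in [n - 1]. *)
Definition is_asmI n (I : {set 'I_n.-1}) (A : asm n) : bool :=
  [forall i in I, forall j : 'I_n,
     rank_mx A i.+1 j.+1 \in [:: rank_mx A i j.+1 + 1; rank_mx A i.+2 j.+1]].

Definition asmI n (I : {set 'I_n.-1}) := {A : asm n | is_asmI I A}.
HB.instance Definition _ n (I : {set 'I_n.-1}) := SubChoice.on (asmI I).
HB.instance Definition _ n (I : {set 'I_n.-1}) :=
  [SubChoice_isSubPOrder of asmI I by <: with asm_display].

(* An alias of 'S_n carrying the Bruhat order. *)
Definition bruhat n := 'S_n.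
HB.instance Definition _ n := Finite.on (bruhat n).

Definition rank_perm n (w : 'S_n) (i j : nat) : nat :=
  #|[pred k : 'I_n | (k < i)%N && (w k < j)%N]|.

Definition bruhat_le n (u v : bruhat n) : bool :=
  [forall i : 'I_n, forall j : 'I_n,
     (rank_perm v i.+1 j.+1 <= rank_perm u i.+1 j.+1)%N].

Lemma rank_mx_perm n (w : 'S_n) i j :
  rank_mx (perm_mx w) i j = (rank_perm w i j)%:Z.
Proof.
rewrite /rank_mx /rank_perm -natz -sum1_card natr_sum [RHS]big_mkcondr /=.
apply: eq_bigr => p _; rewrite big_mkcond (bigD1 (w p)) //= !mxE eqxx.
by rewrite big1 ?addr0 // => q; rewrite !mxE eq_sym => /negPf->; case: ifP.
Qed.

Lemma perm_mx_inj n : injective (fun w : 'S_n => perm_mx w : 'M[int]_n).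
Proof.
move=> u v /matrixP eq_uv; apply/permP => i; apply/esym/eqP.
by have := eq_uv i (u i); rewrite !mxE eqxx; case: eqP.
Qed.

Lemma bruhat_le_refl n : reflexive (@bruhat_le n).
Proof. by move=> u; apply/'forall_forallP => i j. Qed.

Lemma bruhat_le_anti n : antisymmetric (@bruhat_le n).
Proof.
move=> u v /andP[/'forall_forallP le_uv /'forall_forallP le_vu].
apply/perm_mx_inj/rank_mx_inj => i j; rewrite !rank_mx_perm; congr Posz.
by apply/eqP; rewrite eqn_leq le_vu le_uv.
Qed.

Lemma bruhat_le_trans n : transitive (@bruhat_le n).
Proof.
move=> v u w /'forall_forallP le_uv /'forall_forallP le_vw.
by apply/'forall_forallP => i j; apply: leq_trans (le_vw i j) (le_uv i j).
Qed.

Fact bruhat_display : Order.disp_t. Proof. exact: Order.Disp tt tt. Qed.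
HB.instance Definition _ n := Order.Le_isPOrder.Build bruhat_display (bruhat n)
  (@bruhat_le_refl n) (@bruhat_le_anti n) (@bruhat_le_trans n).

(* w(i) < w(i + 1) for i in I; the positions i, i + 1 of [n] have 0-based
   numbers k, l equal to i, i.+1 for the corresponding i : 'I_n.-1. *)
Definition is_min_rep n (I : {set 'I_n.-1}) (w : bruhat n) : bool :=
  [forall i in I, forall k : 'I_n, forall l : 'I_n,
     (k == i :> nat) && (l == i.+1 :> nat) ==> ((w : 'S_n) k < (w : 'S_n) l)%N].

Definition parabolic_bruhat n (I : {set 'I_n.-1}) :=
  {w : bruhat n | is_min_rep I w}.
HB.instance Definition _ n (I : {set 'I_n.-1}) :=
  SubChoice.on (parabolic_bruhat I).
HB.instance Definition _ n (I : {set 'I_n.-1}) :=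
  [SubChoice_isSubPOrder of parabolic_bruhat I by <: with bruhat_display].

Local Open Scope classical_set_scope.

Definition complete_lattice d (L : porderType d) : Prop :=
  forall X : set L, supremums X !=set0 /\ infimums X !=set0.

Definition is_dedekind_macneille d d' (P : porderType d) (L : porderType d')
    (e : P -> L) : Prop :=
  [/\ complete_lattice L,
      {mono e : x y / (x <= y)%O},
      forall x : L, supremums [set e y | y in [set y | (e y <= x)%O]] x
    & forall x : L, infimums [set e y | y in [set y | (x <= e y)%O]] x].

(* Main.v *)
(** Rank matrices of alternating sign matrices are exactly the corner-sum
    matrices: integer arrays whose unit steps are 0 or 1, with r(0,j) = r(i,0) = 0,
    r(n,j) = j and r(i,n) = i.  The condition defining ASM^I says that every column
    of the rank matrix is concave at the rows of I; such a rank matrix is the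
    largest one with the given values on the remaining ("outer") rows, so both the
    order and the elements of ASM^I are determined by the outer rows.

    Concavity and the step conditions survive pointwise minima of rank matrices, so
    all suprema exist, and infima are suprema of lower bounds.  For density it
    is enough to find, for A in ASM^I and an outer position (i,j), an element
    of S_n^I below (above) A with the same rank at (i,j).  In S_n such an element
    is the permutation with the largest (smallest) rank function taking the
    value r_A(i,j) at (i,j); sorting its values inside the blocks of I moves it
    into S_n^I without changing its ranks on outer rows. *)

Require Import Defs.
From mathcomp Require Import all_boot all_order all_fingroup all_algebra.
From mathcomp Require Import boolp classical_sets zify.

Set Implicit Arguments.
Unset Strict Implicit.
Unset Printing Implicit Defensive.

Import Order.TTheory GRing.Theory Num.Theory.
Local Open Scope ring_scope.

(** * Alternating sequences and their prefix sums *)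

(** Nonzero entries after [x] are alternately [- x] and [x], so their running sum switches between
    [- x] and 0. *)
Lemma path_alternating_prefix_sum (x : int) (s : seq int) :
  x \in [:: 1; -1] -> all [in [:: 0; 1; -1]] s ->
  path (fun x y => x * y < 0) x [seq y <- s | y != 0] ->
  forall j, \sum_(y <- take j s) y \in [:: 0; - x].
Proof.
elim: s x => [|y s IHs] x xP /=; first by rewrite big_nil inE.
case/andP=> yP sP; case: eqVneq => [->|y0] /=.
  move=> /(IHs _ xP sP) IH [|j]; first by rewrite big_nil inE.
  by rewrite /= big_cons add0r IH.
case/andP=> xy; have yE : y = - x by move: xP yP xy; rewrite !inE; lia.
have y1 : y \in [:: 1; -1] by move: xP; rewrite !inE yE; lia.
move=> /(IHs _ y1 sP) IH [|j]; first by rewrite big_nil inE.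
by have := IH j; rewrite /= big_cons !inE; lia.
Qed.

(** Prefix sums stay in 0 and the first nonzero entry, and the total 1 forces that entry to be 1. *)
Lemma alternating_prefix_sum (s : seq int) :
  all [in [:: 0; 1; -1]] s ->
  sorted (fun x y => x * y < 0) [seq y <- s | y != 0] ->
  \sum_(y <- s) y = 1 ->
  forall j, \sum_(y <- take j s) y \in [:: 0; 1].
Proof.
move=> sP s_alt s1; suff [y yP sumE] : exists2 y, y \in [:: 1; -1] &
    forall j, \sum_(z <- take j s) z \in [:: 0; y : int].
  have y1 : y = 1.
    by have := sumE (size s); rewrite take_size s1; move: yP; rewrite !inE; lia.
  by move=> j; have := sumE j; rewrite y1.
elim: s sP s_alt {s1} => [|y s IHs] /=.
  by exists 1 => // j; rewrite big_nil inE.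
case/andP=> yP sP; case: eqVneq => [->|y0] /=.
  move=> /(IHs sP)[z zP IH]; exists z => // -[|j]; first by rewrite big_nil inE.
  by rewrite /= big_cons add0r IH.
have y1 : y \in [:: 1; -1] by move: yP; rewrite !inE; lia.
move=> /(path_alternating_prefix_sum y1 sP) IH; exists y => // -[|j].
  by rewrite big_nil inE.
by have := IH j; rewrite /= big_cons !inE; lia.
Qed.

Lemma prefix_sum_path_alternating (x : int) (s : seq int) :
  x \in [:: 1; -1] -> (forall j, \sum_(y <- take j s) y \in [:: 0; - x]) ->
  path (fun x y => x * y < 0) x [seq y <- s | y != 0].
Proof.
elim: s x => [|y s IHs] x xP //= sumP.
have := sumP 1%N; rewrite /= take0 big_seq1 => yP.
case: eqVneq => [y0|y0] /=.
  by apply: IHs => // j; have := sumP j.+1; rewrite /= big_cons y0 add0r.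
have yE : y = - x by move: yP; rewrite !inE; lia.
apply/andP; split; first by move: xP; rewrite yE !inE; lia.
apply: IHs => [|j]; first by move: xP; rewrite yE !inE; lia.
by have := sumP j.+1; rewrite /= big_cons yE !inE; lia.
Qed.

Lemma sum_ltS n (f : 'I_n -> int) (j : 'I_n) :
  \sum_(q < n | (q < j.+1)%N) f q = \sum_(q < n | (q < j)%N) f q + f j.
Proof.
rewrite (bigD1 j) //= addrC; congr (_ + _); apply: eq_bigl => p.
by rewrite ltnS andbC -val_eqE /= ltn_neqAle.
Qed.

Lemma sum_take_enum n (f : 'I_n -> int) j : (j <= n)%N ->
  \sum_(x <- take j [seq f k | k <- enum 'I_n]) x = \sum_(q < n | (q < j)%N) f q.
Proof.
have size_f : size [seq f k | k <- enum 'I_n] = n by rewrite size_map size_enum_ord.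
elim: j => [|j IHj] ltjn; first by rewrite take0 big_nil big_pred0.
rewrite (take_nth 0) ?size_f // big_rcons /= IHj ?(ltnW ltjn) //.
rewrite (nth_map (Ordinal ltjn)) ?size_enum_ord //.
by rewrite (nth_ord_enum _ (Ordinal ltjn)) (sum_ltS _ (Ordinal ltjn)).
Qed.

Lemma sum_lt_full n (f : 'I_n -> int) :
  \sum_(q < n | (q < n)%N) f q = \sum_q f q.
Proof. by apply: eq_bigl => q; rewrite ltn_ord. Qed.

Definition asm_line n (f : 'I_n -> int) :=
  [&& [forall j, f j \in [:: 0; 1; -1]], alternating f & \sum_j f j == 1].

Lemma asm_lineP n (f : 'I_n -> int) :
  reflect ((forall j, (j <= n)%N -> \sum_(q < n | (q < j)%N) f q \in [:: 0; 1])
           /\ \sum_j f j = 1)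
          (asm_line f).
Proof.
have sumE : \sum_(x <- [seq f k | k <- enum 'I_n]) x = \sum_j f j.
  by rewrite big_map big_enum.
apply: (iffP and3P) => [[/forallP fP f_alt /eqP f1]|[sumP f1]].
  split=> // j lejn; rewrite -sum_take_enum //.
  apply: alternating_prefix_sum => //; last by rewrite sumE.
  by apply/allP => _ /mapP[k _ ->]; exact: fP.
split; last exact/eqP.
  apply/forallP => j; have := sumP j.+1 (ltn_ord j).
  by have := sumP j (ltnW (ltn_ord j)); rewrite sum_ltS !inE; lia.
(* A fictitious leading entry -1 encodes that the first nonzero entry must be 1. *)
apply: (@path_sorted _ _ (-1)); apply: prefix_sum_path_alternating => // j.
have [lejn|/ltnW lenj] := leqP j n; first by rewrite sum_take_enum // opprK sumP.
rewrite take_oversize; first by rewrite big_map big_enum /= f1.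
by rewrite size_map size_enum_ord.
Qed.

Lemma is_asmE n (A : 'M[int]_n) :
  is_asm A = [forall i, asm_line (fun j => A i j)]
             && [forall j, asm_line (fun i => A i j)].
Proof.
apply/and5P/andP => [[entryP altr altc sumr sumc]|[/forallP rowP /forallP colP]].
  split; apply/forallP => i; apply/and3P; split;
    rewrite ?(forallP altr) ?(forallP altc) ?(forallP sumr) ?(forallP sumc) //;
    apply/forallP => j; exact: 'forall_forallP entryP _ _.
split; apply/forallP => i; try by case/and3P: (rowP i).
- by case/and3P: (colP i).
by case/and3P: (colP i).
Qed.

(** * Corner-sum matrices and their correspondence with alternating sign matrices *)

Record corner_sum n (r : nat -> nat -> int) : Prop := CornerSum {
  corner0l : forall j, (j <= n)%N -> r 0%N j = 0;
  corner0r : forall i, (i <= n)%N -> r i 0%N = 0;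
  cornernl : forall j, (j <= n)%N -> r n j = j%:Z;
  cornernr : forall i, (i <= n)%N -> r i n = i%:Z;
  cornerSl : forall i j, (i < n)%N -> (j <= n)%N ->
    r i j <= r i.+1 j <= r i j + 1;
  cornerSr : forall i j, (i <= n)%N -> (j < n)%N ->
    r i j <= r i j.+1 <= r i j + 1 }.

Lemma rank_mx_tr n (A : 'M[int]_n) i j : rank_mx A^T i j = rank_mx A j i.
Proof.
rewrite /rank_mx exchange_big; apply: eq_bigr => p _.
by apply: eq_bigr => q _; rewrite mxE.
Qed.

Lemma rank_mxSr n (A : 'M[int]_n) i (j : 'I_n) :
  rank_mx A i j.+1 = rank_mx A i j + \sum_(p < n | (p < i)%N) A p j.
Proof.
rewrite -!(rank_mx_tr A) rank_mxS; congr (_ + _).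
by apply: eq_bigr => p _; rewrite mxE.
Qed.

(** Unit steps of the rank matrix are prefix sums of rows and columns of [A], so the step conditions
    are the prefix conditions of [asm_lineP]; the values on the border encode the line sums. *)
Lemma is_asmP n (A : 'M[int]_n) : reflect (corner_sum n (rank_mx A)) (is_asm A).
Proof.
rewrite is_asmE; apply: (iffP andP) => [[/forallP rowP /forallP colP]|rP].
  have rows i j : (i < n)%N -> (j <= n)%N ->
      rank_mx A i j <= rank_mx A i.+1 j <= rank_mx A i j + 1.
    move=> ltin lejn; have /asm_lineP[/(_ j lejn)] := rowP (Ordinal ltin).
    by rewrite (rank_mxS A (Ordinal ltin)) /= !inE; lia.
  have cols i j : (i <= n)%N -> (j < n)%N ->
      rank_mx A i j <= rank_mx A i j.+1 <= rank_mx A i j + 1.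
    move=> lein ltjn; have /asm_lineP[/(_ i lein)] := colP (Ordinal ltjn).
    by rewrite (rank_mxSr A _ (Ordinal ltjn)) /= !inE; lia.
  split=> // [j _|i _|j|i]; rewrite ?rank_mx0l ?rank_mx0r //.
    elim: j => [|j IHj] ltjn; first exact: rank_mx0r.
    rewrite (rank_mxSr A _ (Ordinal ltjn)) /= IHj ?(ltnW ltjn) // sum_lt_full.
    by have /asm_lineP[_ ->] := colP (Ordinal ltjn); lia.
  elim: i => [|i IHi] ltin; first exact: rank_mx0l.
  rewrite (rank_mxS A (Ordinal ltin)) /= IHi ?(ltnW ltin) // sum_lt_full.
  by have /asm_lineP[_ ->] := rowP (Ordinal ltin); lia.
split; apply/forallP => i; apply/asm_lineP.
  split=> [j lejn|]; first by have := cornerSl rP (ltn_ord i) lejn;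
    rewrite rank_mxS !inE; lia.
  have := rank_mxS A i n; rewrite !(cornernr rP) ?ltn_ord ?(ltnW (ltn_ord i)) //.
  by rewrite sum_lt_full; lia.
split=> [j lejn|]; first by have := cornerSr rP lejn (ltn_ord i);
  rewrite rank_mxSr !inE; lia.
have := rank_mxSr A n i; rewrite !(cornernl rP) ?ltn_ord ?(ltnW (ltn_ord i)) //.
by rewrite sum_lt_full; lia.
Qed.

Lemma corner_sum_asm n (r : nat -> nat -> int) : corner_sum n r ->
  exists A : asm n,
    forall i j, (i <= n)%N -> (j <= n)%N -> rank_mx A i j = r i j.
Proof.
move=> rP.
(* Mixed second differences: summing them over columns and then over rows telescopes back to [r]. *)
pose M : 'M[int]_n := \matrix_(i, j) (r i.+1 j.+1 - r i j.+1 - (r i.+1 j - r i j)).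
have rowE (i : 'I_n) j : (j <= n)%N ->
    \sum_(q < n | (q < j)%N) M i q = r i.+1 j - r i j.
  elim: j => [|j IHj] ltjn.
    by rewrite big_pred0 // !(corner0r rP) ?ltn_ord // ltnW.
  by rewrite (sum_ltS _ (Ordinal ltjn)) IHj ?(ltnW ltjn) // mxE /=; lia.
have rE i j : (i <= n)%N -> (j <= n)%N -> rank_mx M i j = r i j.
  move=> + lejn; elim: i => [|i IHi] ltin; first by rewrite rank_mx0l (corner0l rP).
  by rewrite (rank_mxS M (Ordinal ltin)) rowE //= IHi ?(ltnW ltin) //; lia.
suff MP : is_asm M by exists (Asm MP).
apply/is_asmP; case: rP => r1 r2 r3 r4 r5 r6; split=> *; rewrite !rE //;
  by [exact: ltnW | exact: r1 | exact: r2 | exact: r3 | exact: r4 | exact: r5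
     | exact: r6].
Qed.

Lemma asm_corner_sum n (A : asm n) : corner_sum n (rank_mx A).
Proof. by case: A => A /= /is_asmP. Qed.

Lemma asm_leP n (A B : asm n) :
  reflect (forall i j, (i <= n)%N -> (j <= n)%N -> rank_mx B i j <= rank_mx A i j)
          (A <= B)%O.
Proof.
apply: (iffP 'forall_forallP) => leAB i j; last by apply: leAB; exact: ltn_ord.
case: i j => [|i] [|j]; rewrite ?rank_mx0l ?rank_mx0r // => lti ltj.
exact: (leAB (Ordinal lti) (Ordinal ltj)).
Qed.

Lemma corner_sum_ge0 n r i j : corner_sum n r ->
  (i <= n)%N -> (j <= n)%N -> 0 <= r i j.
Proof.
move=> rP + lejn; elim: i => [|i IHi] ltin; first by rewrite (corner0l rP).
by have := cornerSl rP ltin lejn; have := IHi (ltnW ltin); lia.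
Qed.

(** The subtractions are truncated: only increasing an index can increase [r], by at most 1 per
    step. *)
Lemma corner_sum_lip n r i j a b : corner_sum n r ->
  (i <= n)%N -> (j <= n)%N -> (a <= n)%N -> (b <= n)%N ->
  r a b <= r i j + (a - i)%:Z + (b - j)%:Z.
Proof.
move=> rP lein lejn.
have incr k x y : (x <= n)%N -> (y + k <= n)%N ->
    r x y <= r x (y + k)%N <= r x y + k%:Z
    /\ r y x <= r (y + k)%N x <= r y x + k%:Z.
  move=> lexn; elim: k => [|k IHk]; first by rewrite addn0; lia.
  rewrite addnS => ltyk; have [] := IHk (ltnW ltyk).
  by have := cornerSl rP ltyk lexn; have := cornerSr rP lexn ltyk; lia.
move=> lean lebn; have : r a b <= r i b + (a - i)%:Z.
  have [leai|/ltnW leia] := leqP a i.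
    by have [_] := incr (i - a)%N b a lebn ltac:(lia); rewrite subnKC //; lia.
  by have [_] := incr (a - i)%N b i lebn ltac:(lia); rewrite subnKC //; lia.
have [lebj|/ltnW lejb] := leqP b j.
  by have [+ _] := incr (j - b)%N i b lein ltac:(lia); rewrite subnKC //; lia.
by have [+ _] := incr (b - j)%N i j lein ltac:(lia); rewrite subnKC //; lia.
Qed.

(** This is the effect on ranks of reversing the columns; the minus sign exchanges upper and lower
    bounds. *)
Lemma corner_sum_rev n r : corner_sum n r ->
  corner_sum n (fun i j => i%:Z - r i (n - j)%N).
Proof.
move=> rP; split=> [j _|i lein|j lejn|i lein|i j ltin lejn|i j lein ltjn].
- by rewrite (corner0l rP) ?leq_subr.
- by rewrite subn0 (cornernr rP) ?subrr.
- by rewrite (cornernl rP) ?leq_subr; lia.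
- by rewrite subnn (corner0r rP) ?subr0.
- by have := cornerSl rP ltin (leq_subr j n); lia.
have := cornerSr rP lein (ltac:(lia) : (n - j.+1 < n)%N).
by rewrite subnSK //; lia.
Qed.

(** * Rank functions of permutations, and extremal permutations with one prescribed rank *)

Lemma rank_perm0 n (w : 'S_n) j : rank_perm w 0 j = 0%N.
Proof. by rewrite /rank_perm eq_card0. Qed.

Lemma rank_permS n (w : 'S_n) (i : 'I_n) j :
  rank_perm w i.+1 j = (rank_perm w i j + (w i < j))%N.
Proof.
rewrite /rank_perm (cardD1 i) inE ltnSn addnC; congr (_ + _)%N.
apply: eq_card => k; rewrite !inE ltnS -val_eqE /= andbA; congr (_ && _).
by rewrite -ltn_neqAle.
Qed.

Lemma rank_perm_leq n (w : 'S_n) i j : (i <= n)%N -> (rank_perm w i j <= i)%N.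
Proof.
elim: i => [|i IHi] ltin; first by rewrite rank_perm0.
by rewrite (rank_permS w (Ordinal ltin)) /=; have := IHi (ltnW ltin); lia.
Qed.

Lemma rank_perm_inv n (w : 'S_n) i j : rank_perm w^-1 j i = rank_perm w i j.
Proof.
rewrite /rank_perm -!sum1_card (reindex_inj (@perm_inj _ w)).
by apply: eq_bigl => k; rewrite !inE permK andbC.
Qed.

Lemma corner_sum_perm n (w : 'S_n) : corner_sum n (rank_mx (perm_mx w)).
Proof.
have full u i : (i <= n)%N -> @rank_perm n u i n = i.
  elim: i => [|i IHi] ltin; first exact: rank_perm0.
  by rewrite (rank_permS u (Ordinal ltin)) /= IHi ?(ltnW ltin) // ltn_ord addn1.
split=> *; rewrite !rank_mx_perm.
- by rewrite rank_perm0.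
- by rewrite -rank_perm_inv rank_perm0.
- by rewrite -rank_perm_inv full.
- by rewrite full.
- by rewrite (rank_permS w (Ordinal _)) /=; lia.
by rewrite -!(rank_perm_inv w) (rank_permS w^-1 (Ordinal _)) /=; lia.
Qed.

Definition perm_asm n (w : 'S_n) : asm n :=
  Asm (introT (is_asmP _) (corner_sum_perm w)).

Lemma rank_perm_rev n (w : 'S_n) i j : (i <= n)%N -> (j <= n)%N ->
  rank_perm (w * perm (@rev_ord_inj n))%g i j = (i - rank_perm w i (n - j))%N.
Proof.
move=> + lejn; elim: i => [|i IHi] ltin; first by rewrite !rank_perm0.
rewrite !(rank_permS _ (Ordinal ltin)) /= IHi ?(ltnW ltin) // permM permE /=.
by have := rank_perm_leq w (n - j) (ltnW ltin); have := ltn_ord (w (Ordinal ltin)); lia.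
Qed.

(* The extremal permutation exchanges the intervals [c, i) and [i, i + j - c)
   and fixes all other points. *)
Lemma exists_max_rank_perm n (i j c : nat) :
  (c <= i)%N -> (c <= j)%N -> (i + j <= n + c)%N ->
  exists v : 'S_n, forall a b, (a <= n)%N ->
    rank_perm v a b = minn (minn a b) (c + (a - i) + (b - j)).
Proof.
move=> leci lecj leijn.
pose f k := if (k < c)%N then k else if (k < i)%N then (k + (j - c))%N
            else if (k < i + j - c)%N then (k - (i - c))%N else k.
have f_ord (k : 'I_n) : (f k < n)%N.
  by have := ltn_ord k; rewrite /f; do 3?[case: ifP => ?]; lia.
have f_inj : injective (fun k => Ordinal (f_ord k)).
  move=> k l [fkl]; apply/val_inj; move: fkl; rewrite /f /=.
  by do 6?[case: ifP => ?]; lia.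
exists (perm f_inj) => a b; elim: a => [|a IHa] ltan.
  by rewrite rank_perm0; lia.
rewrite (rank_permS _ (Ordinal ltan)) /= IHa ?(ltnW ltan) // permE /= /f.
by do 3?[case: ifP => ?]; lia.
Qed.

(** The extremal permutation with [c = r i j] works: its rank function is the minimum of the bounds
    that [corner_sum_lip] gives from row 0, column 0 and [(i, j)]. *)
Lemma perm_rank_ge n r i j : corner_sum n r -> (i <= n)%N -> (j <= n)%N ->
  exists2 v : 'S_n, (rank_perm v i j)%:Z = r i j &
    forall a b, (a <= n)%N -> (b <= n)%N -> r a b <= (rank_perm v a b)%:Z.
Proof.
move=> rP lein lejn; have r_ge0 := corner_sum_ge0 rP lein lejn.
have lera a b : (a <= n)%N -> (b <= n)%N -> r a b <= a%:Z.
  by move=> lean lebn; have := corner_sum_lip rP (leq0n n) lebn lean lebn;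
     rewrite (corner0l rP) //; lia.
have lerb a b : (a <= n)%N -> (b <= n)%N -> r a b <= b%:Z.
  by move=> lean lebn; have := corner_sum_lip rP lean (leq0n n) lean lebn;
     rewrite (corner0r rP) //; lia.
(* Comparison with the corner [(n, n)] yields [i + j <= n + c]. *)
have := corner_sum_lip rP lein lejn (leqnn n) (leqnn n); rewrite (cornernl rP) //.
have := lera i j lein lejn; have := lerb i j lein lejn => leri lerj len.
have [|||v vE] := @exists_max_rank_perm n i j `|r i j|; try lia.
exists v => [|a b lean lebn]; rewrite vE //; first by lia.
have := corner_sum_lip rP lein lejn lean lebn.
by have := lera a b lean lebn; have := lerb a b lean lebn; lia.
Qed.

(** Column reversal reduces this to [perm_rank_ge]. *)
Lemma perm_rank_le n r i j : corner_sum n r -> (i <= n)%N -> (j <= n)%N ->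
  exists2 v : 'S_n, (rank_perm v i j)%:Z = r i j &
    forall a b, (a <= n)%N -> (b <= n)%N -> (rank_perm v a b)%:Z <= r a b.
Proof.
move=> rP lein lejn.
have [v vij vge] := perm_rank_ge (corner_sum_rev rP) lein (leq_subr j n).
have ler a b := @corner_sum_ge0 n r a b rP.
exists (v * perm (@rev_ord_inj n))%g => [|a b lean lebn].
  rewrite rank_perm_rev //; move: vij; rewrite subKn //.
  by have := ler i j lein lejn; have := rank_perm_leq v (n - j) lein; lia.
rewrite rank_perm_rev //; have := vge a (n - b)%N lean (leq_subr b n).
by rewrite subKn //; have := ler a b lean lebn; lia.
Qed.

(** * Row concavity, outer rows and sorting inside the blocks of [I] *)

Definition inner_row n (I : {set 'I_n.-1}) (a : nat) : bool :=
  [exists i in I, a == i.+1].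

(** With steps 0 or 1, the disjunction excludes exactly a step 0 into row [i.+1] followed by a step
    1 out of it. *)
Definition row_concave n (I : {set 'I_n.-1}) (r : nat -> nat -> int) : Prop :=
  forall i j, inner_row I i.+1 -> (j <= n)%N ->
    r i.+1 j = r i j + 1 \/ r i.+1 j = r i.+2 j.

Lemma inner_row_bound n (I : {set 'I_n.-1}) a : inner_row I a -> (0 < a < n)%N.
Proof. by case/exists_inP=> i _ /eqP->; have := ltn_ord i; lia. Qed.

Lemma is_asmIP n (I : {set 'I_n.-1}) (A : asm n) :
  reflect (row_concave I (rank_mx A)) (is_asmI I A).
Proof.
apply: (iffP forall_inP) => [AI i j /exists_inP[k kI /eqP[->]]|AI i iI].
  case: j => [_|j ltjn]; first by right; rewrite !rank_mx0r.
  have /forallP/(_ (Ordinal ltjn)) := AI k kI; rewrite !inE /=.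
  by case/orP=> /eqP; [left|right].
apply/forallP => j; rewrite !inE; have inner : inner_row I i.+1 by apply/exists_inP; exists i.
by have [->|->] := AI i j.+1 inner (ltn_ord j); rewrite eqxx ?orbT.
Qed.

(* On an inner row a row-concave [s] is forced to take the largest value allowed
   by the nearest outer rows above and below. *)
Lemma row_concave_le n (I : {set 'I_n.-1}) r s :
  corner_sum n r -> corner_sum n s -> row_concave I s ->
  (forall a j, (a <= n)%N -> (j <= n)%N -> ~~ inner_row I a -> r a j <= s a j) ->
  forall i j, (i <= n)%N -> (j <= n)%N -> r i j <= s i j.
Proof.
move=> rP sP s_concave leK i j lein lejn.
(* By concavity a step 1 out of an inner row is preceded by a step 1, back to an outer row;
   meanwhile [r] gains at most 1 per step. *)
have up a : (a < n)%N -> s a.+1 j = s a j + 1 -> r a j <= s a j.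
  elim: a => [|a IHa] ltan sE; first by rewrite (corner0l rP) ?(corner0l sP).
  have [aI|] := boolP (inner_row I a.+1); last by apply: leK => //; exact: ltnW.
  have [sE'|] := s_concave a j aI lejn; last by lia.
  have := cornerSl rP (ltnW ltan) lejn.
  by have := IHa (ltnW ltan) sE'; lia.
(* Dually, a step 0 into an inner row keeps [s] constant up to the next outer row, while [r] never
   decreases. Rows are counted from the bottom. *)
have down k : (k < n)%N -> s (n - k.+1)%N j = s (n - k)%N j ->
    r (n - k)%N j <= s (n - k)%N j.
  elim: k => [|k IHk] ltkn sE; first by
    rewrite subn0 (cornernl rP) ?(cornernl sP).
  have [kI|] := boolP (inner_row I (n - k.+1)); last by apply: leK; lia.
  have nkE : (n - k.+1 = (n - k.+2).+1)%N by lia.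
  have nkE' : ((n - k.+2).+2 = n - k)%N by lia.
  rewrite nkE in kI; have := s_concave _ j kI lejn; rewrite nkE' -nkE.
  case=> [sE'|sE']; first by lia.
  have := cornerSl rP (ltac:(lia) : (n - k.+1 < n)%N) lejn.
  rewrite [(n - k.+1).+1](_ : _ = n - k)%N; last by lia.
  by have := IHk (ltnW ltkn) sE'; lia.
have [iI|] := boolP (inner_row I i); last exact: leK.
have := inner_row_bound iI; case: i iI lein => // i iI lein /andP[_ ltin].
have [sE|sE] := s_concave i j iI lejn.
  have := cornerSl rP lein lejn; have := up i lein sE; lia.
have := down (n - i.+2)%N; rewrite [(n - (n - i.+2))%N](_ : _ = i.+2); last by lia.
rewrite [(n - (n - i.+2).+1)%N](_ : _ = i.+1); last by lia.
by move/(_ ltac:(lia) sE); have := cornerSl rP ltin lejn; lia.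
Qed.

(* Among the permutations with the prescribed outer ranks, one maximizing
   \sum_k k * w(k) has no descent at a row of I: exchanging the two values would
   increase the sum. *)
Lemma exists_min_rep n (I : {set 'I_n.-1}) (v : 'S_n) :
  exists2 w : bruhat n, is_min_rep I w &
    forall a b, (a <= n)%N -> (b <= n)%N -> ~~ inner_row I a ->
      rank_perm w a b = rank_perm v a b.
Proof.
pose P (w : 'S_n) := [forall a : 'I_n.+1, forall b : 'I_n.+1,
  ~~ inner_row I a ==> (rank_perm w a b == rank_perm v a b)].
have Pv : P v by apply/'forall_forallP => a b; rewrite eqxx implybT.
pose F (w : 'S_n) := (\sum_(k < n) k * w k)%N.
have [w Pw w_max] := arg_maxnP F Pv.
exists w; last first.
  move=> a b lean lebn outer; have /'forall_forallP := Pw.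
  by move/(_ (Ordinal (lean : a < n.+1)%N) (Ordinal (lebn : b < n.+1)%N));
     move/implyP/(_ outer)/eqP.
apply/forall_inP => i iI; apply/'forall_forallP => k l; apply/implyP.
case/andP=> /eqP kE /eqP lE; rewrite ltnNge; apply/negP => le_wlk.
have neq_kl : k != l by rewrite -val_eqE /= kE lE; lia.
have lt_wlk : (w l < w k)%N.
  rewrite ltn_neqAle le_wlk andbT; apply: contra neq_kl => /eqP wE.
  by rewrite eq_sym; apply/eqP/(@perm_inj _ w)/val_inj.
pose w' := (tperm k l * w)%g.
have Pw' : P w'.
  apply/'forall_forallP => a b; apply/implyP => outer.
  have /'forall_forallP/(_ a b)/implyP/(_ outer)/eqP <- := Pw; apply/eqP.
  rewrite /rank_perm -!sum1_card [RHS](reindex_inj (@perm_inj _ (tperm k l))).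
  apply: eq_bigl => x; rewrite !inE permM; congr (_ && _).
  (* The exchange affects only the rank row [i.+1], which separates [k] from [l] and is inner. *)
  have neq_al : a != i.+1 :> nat.
    by apply: contra outer => /eqP->; apply/exists_inP; exists i.
  by case: tpermP => // ->; lia.
have := w_max _ Pw'; apply/negP; rewrite -ltnNge /F.
(* Only the terms at [k] and [l = k + 1] differ; the gain is [w k - w l]. *)
rewrite (bigD1 k) //= (bigD1 l) 1?eq_sym //= [ltnRHS](bigD1 k) //=.
rewrite [X in (_ < _ + X)%N](bigD1 l) 1?eq_sym //= !permM tpermL tpermR !addnA.
rewrite [X in (_ < _ + X)%N](eq_bigr (fun x : 'I_n => x * w x)%N) ?ltn_add2r.
  by rewrite kE lE; lia.
by move=> x /andP[xk xl]; rewrite permM tpermD // eq_sym.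
Qed.

(** * The embedding of [S_n^I] and its density *)

(** At an inner row a step 1 out means that the later, larger value is below [j]; then so is the
    earlier one, and the step in is 1. *)
Lemma min_rep_is_asmI n (I : {set 'I_n.-1}) (w : bruhat n) :
  is_min_rep I w -> is_asmI I (perm_asm w).
Proof.
move=> /forall_inP wI; apply/is_asmIP => i j /exists_inP[k kI /eqP[->]] lejn.
have ltk := ltn_ord k.
have ltkn : (k < n)%N by lia.
have ltSkn : (k.+1 < n)%N by lia.
have /'forall_forallP/(_ (Ordinal ltkn) (Ordinal ltSkn)) := wI k kI.
rewrite !eqxx /= => ltw; rewrite !rank_mx_perm.
by rewrite (rank_permS w (Ordinal ltSkn)) (rank_permS w (Ordinal ltkn)) /=; lia.
Qed.

Definition embed n (I : {set 'I_n.-1}) (w : parabolic_bruhat I) : asmI I :=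
  exist _ (perm_asm (val w)) (min_rep_is_asmI (valP w)).

Lemma embed_le n (I : {set 'I_n.-1}) : {mono @embed n I : u v / (u <= v)%O}.
Proof.
move=> u v; rewrite -!Order.le_val /=.
by apply: eq_forallb => i; apply: eq_forallb => j; rewrite !rank_mx_perm lez_nat.
Qed.

Lemma asmI_leP n (I : {set 'I_n.-1}) (A B : asmI I) :
  reflect (forall i j, (i <= n)%N -> (j <= n)%N ->
             rank_mx (val B) i j <= rank_mx (val A) i j)
          (A <= B)%O.
Proof. by rewrite -Order.le_val; apply: asm_leP. Qed.

Lemma asmI_le_outer n (I : {set 'I_n.-1}) (A B : asmI I) :
  (forall i j, (i <= n)%N -> (j <= n)%N -> ~~ inner_row I i ->
     rank_mx (val B) i j <= rank_mx (val A) i j) ->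
  (A <= B)%O.
Proof.
move=> leAB; apply/asmI_leP/(row_concave_le _ _ _ _) => //;
  by [exact: asm_corner_sum | exact/is_asmIP/valP
     | move=> i j ? ? ?; exact: leAB].
Qed.

Lemma embed_witness n (I : {set 'I_n.-1}) (v : 'S_n) :
  exists w : parabolic_bruhat I, forall i j, (i <= n)%N -> (j <= n)%N ->
    ~~ inner_row I i -> rank_mx (val (embed w)) i j = (rank_perm v i j)%:Z.
Proof.
have [w wI wE] := exists_min_rep I v; exists (exist _ w wI) => i j lein lejn outer.
by rewrite rank_mx_perm wE.
Qed.

(** The order reverses ranks, so the permutation with the larger ranks lies below [A]. *)
Lemma embed_witness_below n (I : {set 'I_n.-1}) (A : asmI I) i j :
  (i <= n)%N -> (j <= n)%N -> ~~ inner_row I i ->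
  exists2 w : parabolic_bruhat I, (embed w <= A)%O &
    rank_mx (val (embed w)) i j = rank_mx (val A) i j.
Proof.
move=> lein lejn outer.
have [v vij vA] := perm_rank_ge (asm_corner_sum (val A)) lein lejn.
have [w wE] := embed_witness I v; exists w; last by rewrite wE.
by apply: asmI_le_outer => a b lean lebn outera; rewrite wE // vA.
Qed.

Lemma embed_witness_above n (I : {set 'I_n.-1}) (A : asmI I) i j :
  (i <= n)%N -> (j <= n)%N -> ~~ inner_row I i ->
  exists2 w : parabolic_bruhat I, (A <= embed w)%O &
    rank_mx (val (embed w)) i j = rank_mx (val A) i j.
Proof.
move=> lein lejn outer.
have [v vij vA] := perm_rank_le (asm_corner_sum (val A)) lein lejn.
have [w wE] := embed_witness I v; exists w; last by rewrite wE.
by apply: asmI_le_outer => a b lean lebn outera; rewrite wE // vA.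
Qed.

(** * Completeness: suprema as pointwise minima of rank matrices *)

Lemma asmI_bottom n (I : {set 'I_n.-1}) :
  exists A : asmI I, forall B : asmI I, (A <= B)%O.
Proof.
have idI : is_min_rep I (1%g : 'S_n).
  apply/forall_inP => i _; apply/'forall_forallP => k l; rewrite !perm1.
  by apply/implyP => /andP[/eqP-> /eqP->].
exists (embed (exist _ (1%g : bruhat n) idI)) => B; apply/asmI_leP => i j lein lejn.
have rB := asm_corner_sum (val B).
have idE k : (k <= n)%N -> rank_perm (1%g : 'S_n) k j = minn k j.
  elim: k => [|k IHk] ltkn; first by rewrite rank_perm0 min0n.
  by rewrite (rank_permS _ (Ordinal ltkn)) /= IHk ?(ltnW ltkn) // perm1 /=; lia.
have := corner_sum_lip rB (leq0n n) lejn lein lejn.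
have := corner_sum_lip rB lein (leq0n n) lein lejn.
rewrite (corner0l rB) // (corner0r rB) // rank_mx_perm /= idE //; lia.
Qed.

Lemma exists_minimizer T (X : set T) (f : T -> nat) : (exists x, X x) ->
  exists x, X x /\ forall y, X y -> (f x <= f y)%N.
Proof.
case=> x Xx; have exP : exists k, `[< exists2 y, X y & f y = k >].
  by exists (f x); apply/asboolP; exists x.
case: (ex_minnP exP) => _ /asboolP[y Xy <-] y_min.
by exists y; split=> // z Xz; apply: y_min; apply/asboolP; exists z.
Qed.

(** Each condition at a position is inherited from a member attaining the minimum there, since [m]
    is no larger than that member at the neighbours. *)
Lemma pointwise_min_concave n (I : {set 'I_n.-1}) (X : set (nat -> nat -> int)) m :
  (forall r, X r -> corner_sum n r /\ row_concave I r) ->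
  (forall i j, (i <= n)%N -> (j <= n)%N ->
    (exists2 r, X r & m i j = r i j) /\ (forall r, X r -> m i j <= r i j)) ->
  corner_sum n m /\ row_concave I m.
Proof.
move=> XP mP.
have att i j (lein : (i <= n)%N) (lejn : (j <= n)%N) := proj1 (mP i j lein lejn).
have low i j r (lein : (i <= n)%N) (lejn : (j <= n)%N) (Xr : X r) :=
  proj2 (mP i j lein lejn) r Xr.
have stepl i j : (i < n)%N -> (j <= n)%N -> m i j <= m i.+1 j <= m i j + 1.
  move=> ltin lejn; have [r Xr rE] := att i j (ltnW ltin) lejn.
  have [s Xs sE] := att i.+1 j ltin lejn.
  have := cornerSl (proj1 (XP r Xr)) ltin lejn.
  have := cornerSl (proj1 (XP s Xs)) ltin lejn.
  have := low i j s (ltnW ltin) lejn Xs; have := low i.+1 j r ltin lejn Xr.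
  by lia.
split; first split=> // [j lejn|i lein|j lejn|i lein|i j lein ltjn].
- have [r Xr ->] := att 0%N j (leq0n n) lejn.
  by rewrite (corner0l (proj1 (XP r Xr))).
- have [r Xr ->] := att i 0%N lein (leq0n n).
  by rewrite (corner0r (proj1 (XP r Xr))).
- have [r Xr ->] := att n j (leqnn n) lejn.
  by rewrite (cornernl (proj1 (XP r Xr))).
- have [r Xr ->] := att i n lein (leqnn n).
  by rewrite (cornernr (proj1 (XP r Xr))).
- have [r Xr rE] := att i j lein (ltnW ltjn).
  have [s Xs sE] := att i j.+1 lein ltjn.
  have := cornerSr (proj1 (XP r Xr)) lein ltjn.
  have := cornerSr (proj1 (XP s Xs)) lein ltjn.
  have := low i j s lein (ltnW ltjn) Xs; have := low i j.+1 r lein ltjn Xr.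
  by lia.
move=> i j iI lejn; have /andP[_ ltin] := inner_row_bound iI.
(* The member attaining the minimum in the middle row decides which alternative holds for [m]. *)
have [r Xr rE] := att i.+1 j (ltnW ltin) lejn.
have := stepl i j (ltnW ltin) lejn; have := stepl i.+1 j ltin lejn.
have := low i j r (ltnW (ltnW ltin)) lejn Xr; have := low i.+2 j r ltin lejn Xr.
by have [] := proj2 (XP r Xr) i j iI lejn; [left|right]; lia.
Qed.

Lemma asmI_supremum n (I : {set 'I_n.-1}) (X : set (asmI I)) :
  exists S : asmI I, supremums X S.
Proof.
have [bot botP] := asmI_bottom I.
(* Adjoining the bottom makes the family nonempty without changing its upper bounds. *)
pose X' : set (asmI I) := fun A => A = bot \/ X A.
(* Ranks are nonnegative, so absolute values lose nothing and give minima over an arbitrary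
   family. *)
pose f i j (A : asmI I) := `|rank_mx (val A) i j|%N.
have [M MP] := choice (fun ij : nat * nat =>
  exists_minimizer (f ij.1 ij.2) (ex_intro X' bot (or_introl erefl))).
pose m i j := rank_mx (val (M (i, j))) i j.
have m_min i j A : (i <= n)%N -> (j <= n)%N -> X' A -> m i j <= rank_mx (val A) i j.
  move=> lein lejn X'A; have [_ /(_ A X'A)] := MP (i, j).
  rewrite -[f _ _ _]/(f i j _) -[f _ _ A]/(f i j A) /f /m.
  have := corner_sum_ge0 (asm_corner_sum (val A)) lein lejn.
  have := corner_sum_ge0 (asm_corner_sum (val (M (i, j)))) lein lejn.
  by lia.
have [|i j lein lejn|mP m_concave] := @pointwise_min_concave n I
    [set rank_mx (val A : 'M_n) | A in X'] m.
- by move=> _ [A _ <-]; split; [exact: asm_corner_sum | exact/is_asmIP/valP].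
- split; last by move=> _ [A X'A <-]; exact: m_min.
  by exists (rank_mx (val (M (i, j)))) => //; exists (M (i, j)); case: (MP (i, j)).
have [S SE] := corner_sum_asm mP.
have SI : is_asmI I S.
  apply/is_asmIP => i j iI lejn; have /andP[_ ltin] := inner_row_bound iI.
  by rewrite !SE // 1?ltnW // 1?ltnW //; exact: m_concave.
exists (exist _ S SI : asmI I).
split=> [A XA|B B_ub]; apply/asmI_leP => i j lein lejn.
  by rewrite /= SE //; apply: m_min => //; right.
(* The minimum at [(i, j)] is a rank of the member [M (i, j)], which lies below [B]. *)
rewrite /= SE //; have /asmI_leP : (M (i, j) <= B)%O; last exact.
by have [[->|/B_ub]] := MP (i, j).
Qed.

Theorem theorem1p1 (n : nat) (n_gt0 : (0 < n)%N) (I : {set 'I_n.-1}) :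
  exists2 e : parabolic_bruhat I -> asmI I,
    forall w : parabolic_bruhat I,
      (val (e w) : 'M[int]_n) = perm_mx (val w)
    & is_dedekind_macneille e.
Proof.
exists (@embed n I) => //; split=> [X||A|A].
- split; first by have [S SP] := asmI_supremum X; exists S.
  have [S [S_ub S_least]] := asmI_supremum (lbound X).
  by exists S; split=> [A XA|B B_lb]; [apply: S_least => B; apply | exact: S_ub].
- exact: embed_le.
- split=> [_ [w leA <-]//|B B_ub]; apply: asmI_le_outer => i j lein lejn outer.
  (* The witness has the rank of [A] at [(i, j)] and lies below every such upper bound [B]. *)
  have [w leA <-] := embed_witness_below A lein lejn outer.
  by have /asmI_leP := B_ub _ (ex_intro2 _ _ w leA erefl); apply.
split=> [_ [w leA <-]//|B B_lb]; apply: asmI_le_outer => i j lein lejn outer.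
have [w leA <-] := embed_witness_above A lein lejn outer.
by have /asmI_leP := B_lb _ (ex_intro2 _ _ w leA erefl); apply.
Qed.
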